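(* Let $\mathcal{B}$ be a real Banach space and let $\mathbb{P}$ be a kernel-based probability measure on $\mathcal{B}$ with mean $\mu\in\mathcal{B}$ and covariance kernel $\mathcal{K}:\mathcal{B}^*\times\mathcal{B}^*\to\mathbb{R}$. Let $u\in\mathrm{range}(\Gamma_{\mathcal{K}}^{\mu})$. Then there exist constants $C_1\ge0$ and $C_2\ge0$ such that for every $n\in\mathbb{N}$, all $L_1,\dots,L_n\in\mathcal{B}^*$ with $A_{\mathcal{K},\mathbf{L}_n}\ne0$ (where $\mathbf{L}_n:=(L_1,\dots,L_n)^T$) and every $L\in\mathcal{B}^*$ there exists a constant $M_{L,\mathbf{L}_n}\ge0$ such that for every $\epsilon_n>0$ and every $\hat{\mathbf{f}}_n\in\mathbb{R}^n$ with $\|\mathbf{L}_nu-\hat{\mathbf{f}}_n\|_2\le\epsilon_n$, $$|Lu-s_{\mathbf{L}_n,\hat{\mathbf{f}}_n,\epsilon_n}(L)|\le C_1\,\sigma_{L|\mathbf{L}_n}+C_2\left|L\mu-\boldsymbol{\beta}_{\mathcal{K},\mathbf{L}_n}(L)^T\mathbf{L}_n\mu\right|+M_{L,\mathbf{L}_n}\,\epsilon_n.$$ (That is, $C_1,C_2$ are independent of $L,\mathbf{L}_n,\hat{\mathbf{f}}_n,\epsilon_n$, and $M_{L,\mathbf{L}_n}$ is independent of $\hat{\mathbf{f}}_n,\epsilon_n$.)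
   Context: Write $L\omega=\langle\omega,L\rangle$ for $\omega\in\mathcal{B}$, $L\in\mathcal{B}^*$ (the dual space), and $\mathbf{L}_n\omega:=(L_1\omega,\dots,L_n\omega)^T\in\mathbb{R}^n$. A Borel probability measure $\mathbb{P}$ on $\mathcal{B}$ is a kernel-based probability measure with mean $\mu\in\mathcal{B}$ and covariance kernel $\mathcal{K}:\mathcal{B}^*\times\mathcal{B}^*\to\mathbb{R}$ if, writing $S_L(\omega):=L\omega$, for every $n$ and all $L_1,\dots,L_n\in\mathcal{B}^*$ the random vector $(S_{L_1},\dots,S_{L_n})^T$ on $\mathcal{B}$ with its Borel $\sigma$-algebra and $\mathbb{P}$ has a (possibly degenerate) multivariate normal distribution with mean vector $\mathbf{L}_n\mu$ and covariance matrix $A_{\mathcal{K},\mathbf{L}_n}:=(\mathcal{K}(L_j,L_k))_{j,k=1}^{n}$. $\mathcal{H}_S$ is the closure of $\mathrm{span}\{S_L:L\in\mathcal{B}^*\}$ in $L_2(\mathcal{B},\mathbb{P})$, and $\Gamma_{\mathcal{K}}^{\mu}:\mathcal{H}_S\to\mathcal{B}$ is the bounded linear operator $\Gamma_{\mathcal{K}}^{\mu}(V):=\int_{\mathcal{B}}\omega V(\omega)\,\mathbb{P}(d\omega)$. Further, $A^{\dagger}$ is the (Moore-Penrose) pseudo-inverse of $A$, $\mathbf{b}_{\mathcal{K},\mathbf{L}_n}(L):=(\mathcal{K}(L,L_1),\dots,\mathcal{K}(L,L_n))^T$, $\boldsymbol{\beta}_{\mathcal{K},\mathbf{L}_n}(L):=A_{\mathcal{K},\mathbf{L}_n}^{\dagger}\mathbf{b}_{\mathcal{K},\mathbf{L}_n}(L)$,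 $$\sigma_{L|\mathbf{L}_n}:=\sqrt{\mathcal{K}(L,L)-\mathbf{b}_{\mathcal{K},\mathbf{L}_n}(L)^TA_{\mathcal{K},\mathbf{L}_n}^{\dagger}\mathbf{b}_{\mathcal{K},\mathbf{L}_n}(L)}.$$ $B_n(\mathbf{z},r)$ is the closed Euclidean ball in $\mathbb{R}^n$ with center $\mathbf{z}$ and radius $r$, and $$\psi_{\mathbf{L}_n}(\mathbf{z}):=\exp\left(-\tfrac12(\mathbf{z}-\mathbf{L}_n\mu)^TA_{\mathcal{K},\mathbf{L}_n}^{\dagger}(\mathbf{z}-\mathbf{L}_n\mu)\right),\qquad \boldsymbol{\eta}_{\mathcal{K},\mathbf{L}_n}^{\epsilon_n}(\mathbf{z}):=\frac{\int_{B_n(\mathbf{z},\epsilon_n)}\mathbf{v}\,\psi_{\mathbf{L}_n}(\mathbf{v})\,d\mathbf{v}}{\int_{B_n(\mathbf{z},\epsilon_n)}\psi_{\mathbf{L}_n}(\mathbf{v})\,d\mathbf{v}},$$ $$s_{\mathbf{L}_n,\hat{\mathbf{f}}_n,\epsilon_n}(L):=L\mu+\mathbf{b}_{\mathcal{K},\mathbf{L}_n}(L)^TA_{\mathcal{K},\mathbf{L}_n}^{\dagger}\left(\boldsymbol{\eta}_{\mathcal{K},\mathbf{L}_n}^{\epsilon_n}(\hat{\mathbf{f}}_n)-\mathbf{L}_n\mu\right).$$ *)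

(* Defs.v *)
From HB Require Import structures.
From mathcomp Require Import all_boot all_order all_algebra.
From mathcomp Require Import all_classical all_reals all_analysis.

Set Implicit Arguments.
Unset Strict Implicit.
Unset Printing Implicit Defensive.

Import Order.TTheory GRing.Theory Num.Theory.
Import numFieldNormedType.Exports.

Local Open Scope classical_set_scope.
Local Open Scope ring_scope.

Notation borelType B := (g_sigma_algebraType (@open B)).

Record dual_space (R : realType) (B : normedModType R) := DualSpace {
  dual_fun :> {linear B -> R^o};
  dual_continuous : continuous (dual_fun : B -> R^o) }.

Definition dual_vec (R : realType) (B : normedModType R) (n : nat)
    (Ls : 'I_n -> dual_space B) (w : B) : 'cV[R]_n :=
  \col_j (Ls j w : R).

Section pseudo_inverse.
Variables (R : realType).

Definition penrose m n (A : 'M[R]_(m, n)) (X : 'M[R]_(n, m)) : Prop :=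
  [/\ A *m X *m A = A, X *m A *m X = X,
      (A *m X)^T = A *m X & (X *m A)^T = X *m A].

(* The default value 0 is never used, see mp_pinvP. *)
Definition mp_pinv m n (A : 'M[R]_(m, n)) : 'M[R]_(n, m) :=
  xget 0 [set X | penrose A X].

Lemma penrose_unique m n (A : 'M[R]_(m, n)) X Y :
  penrose A X -> penrose A Y -> X = Y.
Proof.
move=> [X1 X2 X3 X4] [Y1 Y2 Y3 Y4].
have AXAY : A *m X = A *m Y.
  have e : A *m X = A *m Y *m (A *m X) by rewrite mulmxA Y1.
  by rewrite -X3 e trmx_mul X3 Y3 mulmxA X1.
have XAYA : X *m A = Y *m A.
  have e : X *m A = X *m A *m (Y *m A) by rewrite mulmxA -(mulmxA _ A) -mulmxA Y1.
  by rewrite -X4 e trmx_mul X4 Y4 mulmxA -(mulmxA _ A) -mulmxA X1.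
by rewrite -X2 XAYA -mulmxA AXAY mulmxA Y2.
Qed.

Lemma gram_unitmx r n (D : 'M[R]_(r, n)) : row_free D -> D *m D^T \in unitmx.
Proof.
move=> Dfree; rewrite -row_free_unit -kermx_eq0.
apply/rowV0P => v /sub_kermxP; rewrite mulmxA => vDD0.
have vD0 : v *m D = 0.
  have /matrixP /(_ 0 0) : v *m D *m (v *m D)^T = 0.
    by rewrite trmx_mul mulmxA vDD0 mul0mx.
  rewrite !mxE => /eqP; rewrite psumr_eq0; last first.
    by move=> i _; rewrite [_^T _ _]mxE -expr2 sqr_ge0.
  move=> /allP s0; apply/matrixP => i j; rewrite ord1 [RHS]mxE.
  have /s0 : j \in index_enum 'I_n by rewrite mem_index_enum.
  by rewrite [_^T _ _]mxE -expr2 sqrf_eq0 => /eqP.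
by apply: (row_free_inj Dfree); rewrite mul0mx.
Qed.

Lemma penrose_full_rank m r n (C : 'M[R]_(m, r)) (D : 'M[R]_(r, n)) :
  C^T *m C \in unitmx -> D *m D^T \in unitmx ->
  penrose (C *m D) (D^T *m invmx (D *m D^T) *m (invmx (C^T *m C) *m C^T)).
Proof.
move=> uC uD.
set GD := invmx (D *m D^T); set GC := invmx (C^T *m C); set X := D^T *m _ *m _.
have GDT : GD^T = GD by rewrite trmx_inv trmx_mul trmxK.
have GCT : GC^T = GC by rewrite trmx_inv trmx_mul trmxK.
have AX : C *m D *m X = C *m GC *m C^T.
  by rewrite /X -!mulmxA (mulmxA D D^T) (mulmxA (D *m D^T)) mulmxV// mul1mx.
have XA : X *m (C *m D) = D^T *m GD *m D.
  by rewrite /X -!mulmxA (mulmxA C^T) (mulmxA GC) mulVmx// mul1mx.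
split.
- by rewrite AX -!mulmxA (mulmxA C^T) (mulmxA GC) mulVmx// mul1mx.
- by rewrite XA /X -!mulmxA (mulmxA D D^T) (mulmxA (D *m D^T)) mulmxV// mul1mx.
- by rewrite AX !trmx_mul trmxK GCT mulmxA.
- by rewrite XA !trmx_mul trmxK GDT mulmxA.
Qed.

Lemma mp_pinvP m n (A : 'M[R]_(m, n)) : penrose A (mp_pinv A).
Proof.
suff [X HX] : exists X, penrose A X by apply: (xgetI 0 HX).
have uC : (col_base A)^T *m col_base A \in unitmx.
  rewrite -{2}(trmxK (col_base A)); apply: gram_unitmx.
  by rewrite /row_free mxrank_tr; exact: col_base_full.
have := penrose_full_rank uC (gram_unitmx (row_base_free A)).
by rewrite mulmx_base => PA; eexists; exact: PA.
Qed.

End pseudo_inverse.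

Section lebesgue_cons.
Variables (R : realType) (n : nat).
Local Notation RT := (measurableTypeR R).
Variable m : {sigma_finite_measure set (n.-tuple RT) -> \bar R}.

Let consf (p : RT * n.-tuple RT) : n.+1.-tuple RT := [tuple of p.1 :: p.2].

Let mconsf : measurable_fun setT consf.
Proof. exact: measurable_cons. Qed.

Definition lebesgue_cons : set (n.+1.-tuple RT) -> \bar R :=
  pushforward (@lebesgue_measure R \x m)%E consf.

Let lebesgue_cons0 : lebesgue_cons set0 = 0%E.
Proof. by rewrite /lebesgue_cons /pushforward preimage_set0 measure0. Qed.

Let lebesgue_cons_ge0 A : (0 <= lebesgue_cons A)%E.
Proof. exact: measure_ge0. Qed.

Let lebesgue_cons_sigma_additive : semi_sigma_additive lebesgue_cons.
Proof.
move=> F mF tF mUF; rewrite /lebesgue_cons /pushforward preimage_bigcup.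
apply: measure_semi_sigma_additive.
- by move=> k; rewrite -[X in measurable X]setTI; exact: mconsf.
- apply/trivIsetP => i j _ _ ij; rewrite -preimage_setI.
  by move/trivIsetP : tF => /(_ _ _ _ _ ij) ->//; rewrite preimage_set0.
- by rewrite -preimage_bigcup -[X in measurable X]setTI; exact: mconsf.
Qed.

HB.instance Definition _ := isMeasure.Build _ _ _ lebesgue_cons
  lebesgue_cons0 lebesgue_cons_ge0 lebesgue_cons_sigma_additive.

Let lebesgue_cons_sigma_finite : sigma_finite setT lebesgue_cons.
Proof.
have /sigma_finiteP[F [TF ndF Foo]] := sigma_finiteT (@lebesgue_measure R).
have /sigma_finiteP[G [TG ndG Goo]] := sigma_finiteT m.
pose g (t : n.+1.-tuple RT) : RT * n.-tuple RT := (thead t, [tuple of behead t]).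
have mg : measurable_fun setT g.
  apply/measurable_fun_pair => /=; first exact: measurable_tnth.
  exact: measurable_behead.
have gK p : g (consf p) = p.
  by case: p => x t; congr (_, _); exact/val_inj.
exists (fun k => g @^-1` (F k `*` G k)).
  rewrite -preimage_bigcup; apply/esym; rewrite -[RHS](preimage_setT g).
  congr (_ @^-1` _); apply/seteqP; split => // -[x y] _.
  have [k _ Fkx] : (\bigcup_i F i) x by rewrite -TF.
  have [l _ Gly] : (\bigcup_i G i) y by rewrite -TG.
  exists (maxn k l) => //; split => /=.
    by move: x Fkx; exact/subsetPset/ndF/leq_maxl.
  by move: y Gly; exact/subsetPset/ndG/leq_maxr.
move=> k; have [mFk Fkoo] := Foo k; have [mGk Gkoo] := Goo k; split.
  by rewrite -[X in measurable X]setTI; apply: mg => //; exact: measurableX.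
rewrite /lebesgue_cons /pushforward.
rewrite (_ : consf @^-1` (g @^-1` (F k `*` G k)) = F k `*` G k); last first.
  by apply/funext => p; rewrite -[in RHS](gK p).
by rewrite product_measure1E// lte_mul_pinfty// ge0_fin_numE.
Qed.

HB.instance Definition _ := Measure_isSigmaFinite.Build _ _ _ lebesgue_cons
  lebesgue_cons_sigma_finite.

End lebesgue_cons.

(* Lebesgue measure on R^n: the n-fold product of the one on R *)
Fixpoint lebesgue_tuple (R : realType) (n : nat) :
    {sigma_finite_measure set (n.-tuple (measurableTypeR R)) -> \bar R} :=
  match n with
  | 0 => @dirac _ (0.-tuple (measurableTypeR R)) [tuple] R
  | n'.+1 => lebesgue_cons (lebesgue_tuple R n')
  end.

Section multivariate_normal.
Context d (T : measurableType d) (R : realType) (P : probability T R).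

(* [normal_prob m 0] is a junk value in the library, hence the case s = 0 *)
Definition normal_law (m s : R) : set (measurableTypeR R) -> \bar R :=
  if s == 0 then @dirac _ (measurableTypeR R) m R else normal_prob m s.

Definition normally_distributed (X : T -> R) : Prop :=
  exists m s : R, 0 <= s /\
    forall A : set (measurableTypeR R), measurable A ->
      P (X @^-1` A) = normal_law m s A.

(* The covariance matrix may be singular, so there need not be a density:
   a random vector is Gaussian when all linear combinations of its
   coordinates are Gaussian on the line. *)
Definition multivariate_normal (n : nat) (X : T -> 'cV[R]_n)
    (m : 'cV[R]_n) (Sigma : 'M[R]_n) : Prop :=
  [/\ forall i, measurable_fun setT (fun w => X w i 0),
      forall a : 'cV[R]_n, normally_distributed (fun w => (a^T *m X w) 0 0),
      forall i, ('E_P[(fun w => X w i 0)%R])%E = (m i 0)%:E &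
      forall i j,
        covariance P (fun w => X w i 0) (fun w => X w j 0) = (Sigma i j)%:E].

End multivariate_normal.

Section bochner.
Context d (T : measurableType d) (R : realType) (P : probability T R).
Variable B : normedModType R.

(* The sequence [:: (A_1, v_1); ...; (A_k, v_k)] stands for the simple
   function \1_(A_1) v_1 + ... + \1_(A_k) v_k. *)
Implicit Type s : seq (set T * B).

Definition simple_meas s : Prop := forall p, p \in s -> measurable p.1.

Definition simple_val s (w : T) : B := \sum_(p <- s) \1_(p.1) w *: p.2.

Definition simple_int s : B := \sum_(p <- s) fine (P p.1) *: p.2.

(* f is strongly measurable and Bochner integrable, with integral u. *)
Definition bochner_integral (f : T -> B) (u : B) : Prop :=
  exists s : nat -> seq (set T * B),
    [/\ forall k, simple_meas (s k),
        {ae P, forall w, simple_val (s k) w @[k --> \oo] --> f w},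
        (\int[P]_w (`|f w - simple_val (s k) w|)%:E)%E @[k --> \oo] --> 0%E &
        simple_int (s k) @[k --> \oo] --> u].

End bochner.

Section kernel_based.
Variables (R : realType) (B : completeNormedModType R).
Variable P : probability (borelType B) R.

Definition kernel_mx (K : dual_space B -> dual_space B -> R) (n : nat)
    (Ls : 'I_n -> dual_space B) : 'M[R]_n :=
  \matrix_(j, k) K (Ls j) (Ls k).

Definition kernel_based (mu : B) (K : dual_space B -> dual_space B -> R) : Prop :=
  forall (n : nat) (Ls : 'I_n -> dual_space B),
    multivariate_normal P (dual_vec Ls) (dual_vec Ls mu) (kernel_mx K Ls).

Definition span_dual : set (B -> R) :=
  [set g | exists (k : nat) (a : 'I_k -> R) (Ls : 'I_k -> dual_space B),
     g = fun w => \sum_(i < k) a i * Ls i w].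

(* Elements of L_2(B, P) are given by measurable square-integrable
   representatives. *)
Definition H_S : set (B -> R) :=
  [set V | V \in Lfun P 2%:E /\
     forall e : R, 0 < e -> exists2 g, span_dual g &
       ('N[P]_2%:E[EFin \o (V \- g)%R] < e%:E)%E].

(* Gamma as a relation: u is the Bochner integral of w |-> V(w) w. *)
Definition Gamma (V : B -> R) (u : B) : Prop :=
  bochner_integral P (fun w : B => V w *: w) u.

Definition range_Gamma : set B := [set u | exists2 V, H_S V & Gamma V u].

End kernel_based.

Section interpolant.
Variables (R : realType) (B : completeNormedModType R).
Variables (mu : B) (K : dual_space B -> dual_space B -> R).

Definition kernel_vec (n : nat) (Ls : 'I_n -> dual_space B) (L : dual_space B) : 'cV[R]_n :=
  \col_j K L (Ls j).

Definition kernel_beta (n : nat) (Ls : 'I_n -> dual_space B) (L : dual_space B) : 'cV[R]_n :=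
  mp_pinv (kernel_mx K Ls) *m kernel_vec Ls L.

Definition kernel_sigma (n : nat) (Ls : 'I_n -> dual_space B) (L : dual_space B) : R :=
  Num.sqrt (K L L -
    ((kernel_vec Ls L)^T *m mp_pinv (kernel_mx K Ls) *m kernel_vec Ls L) 0 0).

Definition euclid_norm (n : nat) (v : 'cV[R]_n) : R :=
  Num.sqrt (\sum_(i < n) v i 0 ^+ 2).

Definition kernel_psi (n : nat) (Ls : 'I_n -> dual_space B) (z : 'cV[R]_n) : R :=
  let c := z - dual_vec Ls mu in
  expR (- 2^-1 * (c^T *m mp_pinv (kernel_mx K Ls) *m c) 0 0).

Definition tuple_vec (n : nat) (t : n.-tuple (measurableTypeR R)) : 'cV[R]_n :=
  \col_i tnth t i.

Definition kernel_eta (n : nat) (Ls : 'I_n -> dual_space B) (eps : R) (z : 'cV[R]_n) :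
    'cV[R]_n :=
  let ball_n := [set t | euclid_norm (tuple_vec t - z) <= eps] in
  \col_i
    ((\int[lebesgue_tuple R n]_(t in ball_n) (tnth t i * kernel_psi Ls (tuple_vec t)))
     / \int[lebesgue_tuple R n]_(t in ball_n) kernel_psi Ls (tuple_vec t)).

Definition kernel_interpolant (n : nat) (Ls : 'I_n -> dual_space B) (fhat : 'cV[R]_n) (eps : R)
    (L : dual_space B) : R :=
  L mu + ((kernel_vec Ls L)^T *m mp_pinv (kernel_mx K Ls) *m
            (kernel_eta Ls eps fhat - dual_vec Ls mu)) 0 0.

End interpolant.

(* Main.v *)
Require Import Defs.
From HB Require Import structures.
From mathcomp Require Import all_boot all_order all_algebra.
From mathcomp Require Import all_classical all_reals all_analysis.
From mathcomp Require Import measurable_realfun.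
From mathcomp Require Import ring lra.

(** The theorem rests on one L_2 estimate.  Put
    beta = A^+ b(L) and let D = L - sum_j beta_j L_j be the residual functional
    ([residual]).  Since u is the Bochner integral of V(w) w, applying D under
    the integral gives D u = E[V D] ([Gamma_residual]), so that by
    Cauchy-Schwarz |D u| <= |V|_2 |D|_2.  The second moment of D is its variance
    plus the square of its mean; the variance is a quadratic form in (1, -beta)
    which, because A^+ A A^+ = A^+ and A^+ is symmetric, collapses to
    K(L,L) - b^T A^+ b = sigma^2 ([residual_second_moment]).  Hence
    |D u| <= |V|_2 (sigma + |D mu|) ([residual_bound]), and D mu is exactly the
    bias term L mu - beta^T L_n mu.

    The interpolation error splits as
    L u - s(L) = D u - D mu + beta^T (L_n u - eta)  ([interpolant_error]).
    The first two terms give C1 = |V|_2 and C2 = |V|_2 + 1.  For the last one,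
    eta is a weighted mean of points of the ball of radius eps around the data,
    so each of its coordinates is within eps of the datum ([kernel_eta_near]),
    itself within eps of L_j u: M = 2 sum_j |beta_j| works.  Being a weighted
    mean requires the weight to have a positive finite integral: psi is bounded
    away from 0 and oo on the ball, and the ball has positive finite volume
    because it lies between two cubes ([lebesgue_euclid_ball]). *)

Set Implicit Arguments.
Unset Strict Implicit.
Unset Printing Implicit Defensive.

Import Order.TTheory GRing.Theory Num.Theory.
Import numFieldNormedType.Exports.

Local Open Scope classical_set_scope.
Local Open Scope ring_scope.

(** * Integrals of real functions *)
Section real_integrals.
Context d (T : measurableType d) (R : realType) (mu : {measure set T -> \bar R}).
Import HBNNSimple.

(** The integral of a nonnegative function is a supremum over simple functions
    below it, so monotonicity holds without measurability.  This matters for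
    |f - s_k|, where s_k are simple functions with values in a Banach space that
    may be nonseparable: the norm of a difference is not obviously measurable. *)
Lemma ge0_integral_le (f g : T -> \bar R) :
  (forall x, 0 <= f x)%E -> (forall x, f x <= g x)%E ->
  (\int[mu]_x f x <= \int[mu]_x g x)%E.
Proof.
move=> f0 fg; have g0 x : (0 <= g x)%E by exact: le_trans (fg x).
rewrite !ge0_integralTE//; apply: le_ereal_sup => _ [h hf <-].
by exists h => // x; exact: le_trans (fg x).
Qed.

Lemma integrable_real_fin_num (f : T -> R) : measurable_fun setT f ->
  (\int[mu]_x (f x)%:E)%E \is a fin_num -> mu.-integrable setT (EFin \o f).
Proof.
move=> mf; rewrite -integral_fin_num_abs// => foo.
by apply/integrableP; split => //; exact/measurable_EFinP.
Qed.

Lemma integrable_realD (f g : T -> R) :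
  mu.-integrable setT (EFin \o f) -> mu.-integrable setT (EFin \o g) ->
  mu.-integrable setT (EFin \o (fun x => f x + g x)).
Proof.
move=> fi gi; rewrite (_ : _ \o _ = (EFin \o f) \+ (EFin \o g))%E//.
exact: integrableD.
Qed.

Lemma integrable_realZ (k : R) (f : T -> R) :
  mu.-integrable setT (EFin \o f) ->
  mu.-integrable setT (EFin \o (fun x => k * f x)).
Proof.
move=> fi; rewrite (_ : _ \o _ = (fun x => k%:E * (EFin \o f) x))%E//.
exact: integrableZl.
Qed.

Lemma integrable_real_sum n (F : 'I_n -> T -> R) :
  (forall i, mu.-integrable setT (EFin \o F i)) ->
  mu.-integrable setT (EFin \o (fun x => \sum_(i < n) F i x)).
Proof.
move=> Fi; rewrite (_ : _ \o _ = (fun x => \sum_(i < n) (EFin \o F i) x)%E).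
  exact: integrable_sum.
by apply/funext => x /=; rewrite sumEFin.
Qed.

Lemma Rintegral_sum n (F : 'I_n -> T -> R) :
  (forall i, mu.-integrable setT (EFin \o F i)) ->
  \int[mu]_x (\sum_(i < n) F i x) = \sum_(i < n) \int[mu]_x F i x.
Proof.
move=> Fi; rewrite /Rintegral.
under eq_integral do rewrite -sumEFin.
rewrite (integral_sum measurableT Fi).
rewrite (eq_bigr (fun i => (\int[mu]_x F i x)%:E)) ?sumEFin// => i _.
by rewrite fineK//; exact: (integrable_fin_num measurableT (Fi i)).
Qed.

Lemma integrable_mul_sqr (f g : T -> R) :
  measurable_fun setT f -> measurable_fun setT g ->
  mu.-integrable setT (EFin \o (fun x => f x ^+ 2)) ->
  mu.-integrable setT (EFin \o (fun x => g x ^+ 2)) ->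
  mu.-integrable setT (EFin \o (fun x => f x * g x)).
Proof.
move=> mf mg fi gi.
apply: (le_integrable measurableT _ _ (integrable_realD fi gi)).
  by apply/measurable_EFinP; exact: measurable_funM.
move=> x _ /=; rewrite lee_fin [leRHS]ger0_norm ?addr_ge0 ?sqr_ge0//.
rewrite normrM -(real_normK (num_real (f x))) -(real_normK (num_real (g x))).
have := sqr_ge0 (`|f x| - `|g x|).
have := mulr_ge0 (normr_ge0 (f x)) (normr_ge0 (g x)).
by rewrite sqrrB -mulr_natr; lra.
Qed.

Lemma sqr_le_of_quadratic_ge0 (a b c : R) :
  0 <= a -> (forall t, 0 <= t ^+ 2 * a + 2 * t * b + c) -> b ^+ 2 <= a * c.
Proof.
rewrite le_eqVlt => /predU1P[<-|a0] h.
  rewrite mul0r; have [->|b0] := eqVneq b 0; first by rewrite expr0n.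
  have := h (- (c + 1) / (2 * b)); rewrite mulr0 add0r.
  (* t is the point where the affine function 2 t b + c takes the value -1. *)
  rewrite (_ : 2 * _ * b + c = -1); first by rewrite ler0N1.
  by field.
(* - b / a minimises the quadratic. *)
have := h (- b / a); rewrite (_ : _ + c = (a * c - b ^+ 2) / a); last first.
  by field; rewrite gt_eqF.
by rewrite pmulr_lge0 ?invr_gt0// subr_ge0.
Qed.

(** The quadratic t |-> int (t f + g)^2 is nonnegative, so its discriminant is
    nonpositive. *)
Lemma cauchy_schwarz_Rintegral (f g : T -> R) :
  measurable_fun setT f -> measurable_fun setT g ->
  mu.-integrable setT (EFin \o (fun x => f x ^+ 2)) ->
  mu.-integrable setT (EFin \o (fun x => g x ^+ 2)) ->
  `|\int[mu]_x (f x * g x)| <=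
    Num.sqrt (\int[mu]_x (f x ^+ 2)) * Num.sqrt (\int[mu]_x (g x ^+ 2)).
Proof.
move=> mf mg fi gi.
have fgi := integrable_mul_sqr mf mg fi gi.
have f0 : 0 <= \int[mu]_x (f x ^+ 2) by apply: Rintegral_ge0 => x _; exact: sqr_ge0.
rewrite -sqrtrM// -sqrtr_sqr ler_wsqrtr//.
apply: sqr_le_of_quadratic_ge0 => // t.
rewrite -(RintegralZl (t ^+ 2) measurableT fi).
rewrite -(RintegralZl (2 * t) measurableT fgi).
rewrite -(RintegralD measurableT (integrable_realZ _ fi) (integrable_realZ _ fgi)).
rewrite -(RintegralD measurableT _ gi); last first.
  by apply: integrable_realD; apply: integrable_realZ.
apply: Rintegral_ge0 => x _.
rewrite (_ : _ + _ = (t * f x + g x) ^+ 2) ?sqr_ge0//; ring.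
Qed.

End real_integrals.

(** * Functionals commute with the Bochner integral *)
Section dual_bochner.
Context d (T : measurableType d) (R : realType) (P : probability T R).
Variable B : normedModType R.

Lemma dual_bounded (L : dual_space B) :
  exists2 C : R, 0 < C & forall x, `|L x| <= C * `|x|.
Proof.
have /linear_bounded_continuous/linear_boundedP [y [yr yL]] :=
  @dual_continuous _ _ L.
exists (Num.max y 0 + 1); first by rewrite ltr_wpDl// le_max lexx orbT.
by apply: yL; rewrite (@le_lt_trans _ _ (Num.max y 0)) ?le_max ?lexx// ltrDl.
Qed.

Lemma dual_simple_int (L : dual_space B) (s : seq (set T * B)) :
  simple_meas s ->
  P.-integrable setT (EFin \o (fun w => L (simple_val s w) : R)) /\
  L (simple_int P s) = \int[P]_w (L (simple_val s w) : R).
Proof.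
elim: s => [|p s ih] ms.
  have e : (fun w => L (simple_val [::] w) : R) = cst 0 :> (T -> R).
    by apply/funext => w; rewrite /simple_val big_nil linear0.
  rewrite e; split; first exact: finite_measure_integrable_cst.
  by rewrite Rintegral_cst// mul0r /simple_int big_nil linear0.
have [|si sL] := ih; first by move=> q qs; apply: ms; rewrite inE qs orbT.
have mp : measurable p.1 by apply: ms; rewrite mem_head.
have e : (fun w => L (simple_val (p :: s) w) : R) =
    (fun w => (L p.2 : R) * \1_(p.1) w + (L (simple_val s w) : R)).
  apply/funext => w; rewrite /simple_val big_cons linearD linearZ/=.
  by rewrite [X in X + _]mulrC.
have ip := integrable_indic P mp.
have ip' := integrable_realZ (L p.2 : R) ip.
rewrite e; split; first exact: integrable_realD.
rewrite RintegralD// RintegralZl// -sL /simple_int big_cons linearD linearZ/=.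
by rewrite /Rintegral integral_indic// setIT [X in X + _]mulrC.
Qed.

(** On simple functions this is linearity; a bounded L satisfies
    |E[L f] - E[L s_k]| <= C E|f - s_k|, which tends to 0, while L maps the
    integrals of the s_k to a sequence converging to L u. *)
Lemma dual_bochner_integral (L : dual_space B) (f : T -> B) (u : B) :
  P.-integrable setT (EFin \o (fun w => L (f w) : R)) ->
  bochner_integral P f u -> L u = \int[P]_w (L (f w) : R).
Proof.
move=> Lf [s [ms _ s0 su]].
have [C C0 LC] := dual_bounded L.
have Lsu : (L (simple_int P (s k)) : R) @[k --> \oo] --> (L u : R).
  exact: (cvg_comp _ _ su (@dual_continuous _ _ L u)).
apply: (cvg_unique _ Lsu) => //.
apply/cvgrPdist_le => e e0.
have /fine_cvgP[fs /cvgrPdist_le/(_ (e / C) (divr_gt0 e0 C0)) es] := s0.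
near=> k.
have [si ->] := dual_simple_int L (ms k).
rewrite -RintegralB//.
have di : P.-integrable setT
    (EFin \o (fun w => (L (f w) : R) - (L (simple_val (s k) w) : R))).
  rewrite (_ : _ \o _ = (EFin \o (fun w => L (f w) : R)) \-
    (EFin \o (fun w => L (simple_val (s k) w) : R)))%E//.
  exact: integrableB.
apply: (le_trans (le_normr_Rintegral measurableT di)).
rewrite -[e](divfK (lt0r_neq0 C0)) -ler_pdivrMr//.
have fk : (\int[P]_w (`|f w - simple_val (s k) w|)%:E)%E \is a fin_num.
  by near: k.
have ek : `|0 - fine (\int[P]_w (`|f w - simple_val (s k) w|)%:E)%E| <= e / C.
  by near: k; exact: es.
apply: le_trans ek; rewrite sub0r normrN ger0_norm; last first.
  by rewrite fine_ge0// integral_ge0.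
rewrite mulrC -RintegralZl//; last exact: integrable_norm di.
apply: fine_le => //.
  by apply: integrable_fin_num => //; apply: integrable_realZ; exact: integrable_norm di.
apply: ge0_integral_le => w; rewrite lee_fin.
  by rewrite mulr_ge0// invr_ge0 ltW.
by rewrite mulrC ler_pdivrMr// [leRHS]mulrC -linearB LC.
Unshelve. all: by end_near. Qed.

End dual_bochner.

(** * Volume of Euclidean balls *)
Section lebesgue_box.
Variable R : realType.

Definition box n (a : 'I_n -> R) (h : R) : set (n.-tuple (measurableTypeR R)) :=
  [set t | forall i, a i <= tnth t i <= a i + h].

Lemma measurable_box n (a : 'I_n -> R) h : measurable (box a h).
Proof.
rewrite (_ : box a h =
  \bigcap_(i in [set: 'I_n])
    ((@tnth n (measurableTypeR R))^~ i @^-1` `[a i, a i + h])); last first.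
  by apply/seteqP; split=> [t bt i _|t bt i]; have := bt i; rewrite /= in_itv/= => ->.
apply: fin_bigcap_measurable => // i _.
rewrite -[X in measurable X]setTI.
exact: (measurable_tnth i measurableT (measurable_itv _)).
Qed.

Lemma lebesgue_tuple_box n (a : 'I_n -> R) h : 0 <= h ->
  lebesgue_tuple R n (box a h) = (h ^+ n)%:E.
Proof.
move=> h0; elim: n a => [|n ih] a.
  rewrite /= diracE mem_set ?expr0//= => i; by case: i.
rewrite /= /lebesgue_cons /pushforward.
rewrite (_ : _ @^-1` _ = `[a ord0, a ord0 + h] `*` box (a \o lift ord0) h); last first.
  apply/seteqP; split=> [[x t]/= bt|[x t]/= []].
    split; first by have := bt ord0; rewrite tnth0 in_itv.
    by move=> i; have := bt (lift ord0 i); rewrite tnthS.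
  rewrite in_itv/= => xa bt i; have [j ->|->] := unliftP ord0 i.
    by rewrite tnthS; exact: bt.
  by rewrite tnth0.
rewrite product_measure1E; [|exact: measurable_itv|exact: measurable_box].
transitivity (lebesgue_measure [set` `[a ord0, a ord0 + h]%R] * (h ^+ n)%:E)%E.
  by congr (_ * _)%E; exact: ih.
rewrite lebesgue_measure_itv/= lte_fin ltrDl.
move: h0; rewrite le_eqVlt => /predU1P[<-|->].
  by rewrite ltxx mul0e expr0n.
by rewrite -EFinB -EFinM addrAC subrr add0r exprS.
Qed.

End lebesgue_box.

Section euclid_ball.
Variable R : realType.

Definition euclid_ball n (z : 'cV[R]_n) (e : R) : set (n.-tuple (measurableTypeR R)) :=
  [set t | euclid_norm (tuple_vec t - z) <= e].

Lemma euclid_norm_le n (v : 'cV[R]_n) e : 0 <= e ->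
  (euclid_norm v <= e) = (\sum_(i < n) v i 0 ^+ 2 <= e ^+ 2).
Proof.
by move=> e0; rewrite -[in LHS](ger0_norm e0) -sqrtr_sqr ler_sqrt ?sqr_ge0.
Qed.

Lemma euclid_norm_coord n (v : 'cV[R]_n) i : `|v i 0| <= euclid_norm v.
Proof.
rewrite -sqrtr_sqr ler_wsqrtr// (bigD1 i)//= lerDl.
by apply: sumr_ge0 => j _; exact: sqr_ge0.
Qed.

Lemma measurable_euclid_ball n (z : 'cV[R]_n) e : 0 <= e ->
  measurable (euclid_ball z e).
Proof.
move=> e0; pose s (t : n.-tuple (measurableTypeR R)) : measurableTypeR R :=
  \sum_(i < n) (tnth t i - z i 0) ^+ 2.
rewrite (_ : euclid_ball z e = setT `&` s @^-1` `]-oo, e ^+ 2]); last first.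
  rewrite setTI; apply/seteqP; split=> t; rewrite /euclid_ball /= in_itv/= euclid_norm_le//;
    by congr (_ <= _); apply: eq_bigr => i _; rewrite !mxE.
have ms : measurable_fun setT s.
  apply: measurable_sum => i; apply: measurable_funX; apply: measurable_funB => //.
  exact: measurable_tnth.
exact: (ms measurableT _ (measurable_itv _)).
Qed.

(** The ball of radius e contains the cube of half-side e / (n + 1) and lies in
    the cube of half-side e. *)
Lemma lebesgue_euclid_ball n (z : 'cV[R]_n) e : 0 < e ->
  (0 < lebesgue_tuple R n (euclid_ball z e) < +oo)%E.
Proof.
move=> e0; have mb := measurable_euclid_ball z (ltW e0).
pose r := e / n.+1%:R.
have r0 : 0 < r by rewrite divr_gt0// ltr0n.
apply/andP; split.
  apply: (@lt_le_trans _ _ (lebesgue_tuple R n (box (fun i => z i 0 - r) (2 * r)))).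
    by rewrite lebesgue_tuple_box ?lte_fin ?exprn_gt0// ?mulr_ge0// ?mulr_gt0// ltW.
  apply: le_measure; rewrite ?inE//; first exact: measurable_box.
  move=> t bt; rewrite /euclid_ball /= (euclid_norm_le _ (ltW e0)).
  apply: (@le_trans _ _ (\sum_(i < n) r ^+ 2)).
    apply: ler_sum => i _; rewrite !mxE -real_normK ?num_real//.
    rewrite lerXn2r ?nnegrE ?(ltW r0)// ler_norml.
    by have /andP[] := bt i; rewrite lerBlDr lerBrDl; lra.
  (* n (e / (n + 1))^2 <= e^2; dividing by n + 1 rather than by the square root
     of n also covers n = 0. *)
  rewrite sumr_const card_ord /r expr_div_n -[leLHS]mulr_natr mulrAC.
  rewrite ler_pdivrMr ?exprn_gt0 ?ltr0n//.
  rewrite ler_pM2l ?exprn_gt0// -natrX ler_nat.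
  by rewrite (leq_trans (leqnSn n))// -{1}(expn1 n.+1) leq_pexp2l.
apply: (@le_lt_trans _ _ (lebesgue_tuple R n (box (fun i => z i 0 - e) (2 * e)))).
  apply: le_measure; rewrite ?inE//; first exact: measurable_box.
  move=> t bt i; have := le_trans (euclid_norm_coord _ i) bt.
  rewrite !mxE ler_norml => /andP[]; lra.
by rewrite lebesgue_tuple_box ?ltry// mulr_ge0// ltW.
Qed.

End euclid_ball.

(** * The weighted mean of a ball *)

(** The bounds on the weight w make its integral positive and everything
    integrable; then the difference is the w-mean of g - z, whose absolute value
    is at most e. *)
Lemma weighted_mean_near d (T : measurableType d) (R : realType)
    (m : {measure set T -> \bar R}) (D : set T) (g w : T -> R) (z e c C : R) :
  measurable D -> (0 < m D < +oo)%E ->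
  measurable_fun setT g -> measurable_fun setT w ->
  0 < c -> (forall t, D t -> c <= w t <= C) ->
  (forall t, D t -> `|g t - z| <= e) ->
  `|(\int[m]_(t in D) (g t * w t)) / (\int[m]_(t in D) w t) - z| <= e.
Proof.
move=> mD /andP[D0 Doo] mg mw c0 wcC gz.
have bi (f : T -> R) (M : R) : measurable_fun setT f ->
    (forall t, D t -> `|f t| <= M) -> m.-integrable D (EFin \o f).
  move=> mf fM; apply: measurable_bounded_integrable => //.
    exact: measurable_funTS.
  exists M; split; first exact: num_real.
  by move=> y My t Dt /=; apply: le_trans (fM t Dt) (ltW My).
have w0 t : D t -> 0 <= w t.
  by move=> /wcC/andP[+ _]; apply: le_trans; exact: ltW.
have wM t : D t -> `|w t| <= C.
  by move=> Dt; rewrite ger0_norm ?w0//; have /andP[] := wcC t Dt.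
have iw := bi w C mw wM.
have mgz : measurable_fun setT (fun t => g t - z) by exact: measurable_funB.
have gzM t : D t -> `|(g t - z) * w t| <= e * C.
  by move=> Dt; rewrite normrM ler_pM ?gz ?wM.
have igz := bi _ _ (measurable_funM mgz mw) gzM.
have wpos : 0 < \int[m]_(t in D) w t.
  apply: (@lt_le_trans _ _ (\int[m]_(t in D) c)).
    by rewrite Rintegral_cst// mulr_gt0// fine_gt0// D0.
  apply: le_Rintegral => //; last by move=> t /wcC/andP[].
  by apply: (bi (cst c) `|c|).
have -> : \int[m]_(t in D) (g t * w t) =
    \int[m]_(t in D) ((g t - z) * w t) + z * \int[m]_(t in D) w t.
  rewrite -RintegralZl// -RintegralD//; last first.
    rewrite (_ : _ \o _ = (fun x => z%:E * (EFin \o w) x))%E//.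
    exact: integrableZl.
  by apply: eq_Rintegral => t _; ring.
rewrite mulrDl mulfK ?gt_eqF// addrK normrM normfV (gtr0_norm wpos).
rewrite ler_pdivrMr// -RintegralZl//.
apply: (le_trans (le_normr_Rintegral mD igz)).
apply: le_Rintegral => //.
- exact: integrable_norm igz.
- rewrite (_ : _ \o _ = (fun x => e%:E * (EFin \o w) x))%E//.
  exact: integrableZl.
- by move=> t Dt; rewrite normrM (ger0_norm (w0 t Dt)) ler_wpM2r ?w0 ?gz.
Qed.

Lemma quad_formE (R : comPzRingType) n (A : 'M[R]_n) (c : 'cV[R]_n) :
  (c^T *m A *m c) 0 0 = \sum_j \sum_i c i 0 * A i j * c j 0.
Proof.
rewrite mxE; apply: eq_bigr => j _; rewrite mxE mulr_suml.
by apply: eq_bigr => i _; rewrite mxE.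
Qed.

Lemma quad_form_bounded (R : realDomainType) n (A : 'M[R]_n) (c r : 'cV[R]_n) :
  (forall i, `|c i 0| <= r i 0) ->
  `|(c^T *m A *m c) 0 0| <= \sum_j \sum_i r i 0 * `|A i j| * r j 0.
Proof.
move=> cr; rewrite quad_formE (le_trans (ler_norm_sum _ _ _))// ler_sum// => j _.
rewrite (le_trans (ler_norm_sum _ _ _))// ler_sum// => i _.
by rewrite !normrM !ler_pM// mulr_ge0.
Qed.

Section kernel_eta_near.
Variables (R : realType) (B : completeNormedModType R).
Variables (mu : B) (K : dual_space B -> dual_space B -> R).

Lemma measurable_kernel_psi n (Ls : 'I_n -> dual_space B) :
  measurable_fun [set: n.-tuple (measurableTypeR R)]
    (fun t => kernel_psi mu K Ls (tuple_vec t)).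
Proof.
apply: (measurableT_comp (@measurable_expR R)).
apply: measurable_funM => //.
under eq_fun do rewrite quad_formE.
have mc i : measurable_fun [set: n.-tuple (measurableTypeR R)]
    (fun t => (tuple_vec t - dual_vec Ls mu) i 0).
  under eq_fun do rewrite !mxE.
  by apply: measurable_funB => //; exact: measurable_tnth.
apply: measurable_sum => j; apply: measurable_sum => i.
by apply: measurable_funM => //; exact: measurable_funM.
Qed.

Lemma kernel_eta_near n (Ls : 'I_n -> dual_space B) eps (z : 'cV[R]_n) i :
  0 < eps -> `|kernel_eta mu K Ls eps z i 0 - z i 0| <= eps.
Proof.
move=> e0; rewrite /kernel_eta mxE.
(* r bounds the coordinates of t - L_n mu on the ball, hence Q bounds the
   quadratic form in the exponent of psi. *)
pose r : 'cV[R]_n := \col_k (eps + `|z k 0 - dual_vec Ls mu k 0|).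
pose Q := \sum_j \sum_i r i 0 * `|mp_pinv (kernel_mx K Ls) i j| * r j 0.
apply: (@weighted_mean_near _ _ _ (lebesgue_tuple R n) (euclid_ball z eps)
  (fun t => tnth t i) (fun t => kernel_psi mu K Ls (tuple_vec t)) _ _
  (expR (- 2^-1 * Q)) (expR (2^-1 * Q))).
- exact: measurable_euclid_ball (ltW e0).
- exact: lebesgue_euclid_ball.
- exact: measurable_tnth.
- exact: measurable_kernel_psi.
- exact: expR_gt0.
- move=> t Dt; rewrite /kernel_psi !ler_expR.
  suff : `|((tuple_vec t - dual_vec Ls mu)^T *m mp_pinv (kernel_mx K Ls) *m
      (tuple_vec t - dual_vec Ls mu)) 0 0| <= Q.
    by rewrite ler_norml => /andP[]; lra.
  apply: quad_form_bounded => k.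
  have /= := le_trans (euclid_norm_coord _ k) Dt.
  rewrite !mxE => tz; rewrite -(subrKA (z k 0)).
  by rewrite (le_trans (ler_normD _ _))// lerD2r.
- move=> t Dt; have := le_trans (euclid_norm_coord _ i) Dt.
  by rewrite !mxE.
Qed.

End kernel_eta_near.

(** * Second moments *)
Section gaussian_moments.
Context d (T : measurableType d) (R : realType) (P : probability T R).

(** An extended-real integral is finite only when both the positive and the
    negative part have finite integrals, so a finite mean forces integrability;
    the same applies to covariances. *)
Lemma mean_integrable (X : T -> R) (m : R) : measurable_fun setT X ->
  'E_P[X]%E = m%:E ->
  P.-integrable setT (EFin \o X) /\ \int[P]_w X w = m.
Proof.
rewrite unlock => mX Xm; split; last by rewrite /Rintegral Xm.
by apply: integrable_real_fin_num => //; rewrite Xm.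
Qed.

Lemma covariance_second_moment (X Y : T -> R) (mX mY s : R) :
  measurable_fun setT X -> measurable_fun setT Y ->
  'E_P[X]%E = mX%:E -> 'E_P[Y]%E = mY%:E -> covariance P X Y = s%:E ->
  P.-integrable setT (EFin \o (fun w => X w * Y w)) /\
  \int[P]_w (X w * Y w) = s + mX * mY.
Proof.
move=> meX meY EX EY cXY.
have [iX IX] := mean_integrable meX EX; have [iY IY] := mean_integrable meY EY.
have mc : measurable_fun setT (fun w => (X w - mX) * (Y w - mY)).
  by apply: measurable_funM; apply: measurable_funB.
move: cXY; rewrite unlock EX EY => /(mean_integrable mc)[ic Ic].
have i1 : P.-integrable setT (EFin \o (fun=> - (mX * mY) : R)).
  exact: finite_measure_integrable_cst.
have iXY := integrable_realD ic (integrable_realD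
  (integrable_realD (integrable_realZ mY iX) (integrable_realZ mX iY)) i1).
have e w : X w * Y w =
    (X w - mX) * (Y w - mY) + (mY * X w + mX * Y w + - (mX * mY)) by ring.
have -> : (fun w => X w * Y w) = (fun w => (X w - mX) * (Y w - mY) +
    (mY * X w + mX * Y w + - (mX * mY))) by apply/funext.
split=> //.
rewrite RintegralD//; last first.
  by do 2?apply: integrable_realD => //; apply: integrable_realZ.
rewrite RintegralD//; last by apply: integrable_realD; apply: integrable_realZ.
rewrite RintegralD//; [|by apply: integrable_realZ..].
have -> : \int[P]_w (- (mX * mY)) = - (mX * mY).
  by rewrite Rintegral_cst//= [X in fine X](probability_setT P) mulr1.
by rewrite !RintegralZl// IX IY Ic; ring.
Qed.

End gaussian_moments.

(** * Symmetry of the pseudo-inverse *)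
Section mp_pinv_symmetric.
Variable R : realType.

Lemma penrose_trmx m n (A : 'M[R]_(m, n)) X : penrose A X -> penrose A^T X^T.
Proof.
by move=> [e1 e2 e3 e4]; split; rewrite -?trmx_mul ?mulmxA ?e1 ?e2 ?e3 ?e4 ?trmxK//.
Qed.

(** The transpose of a pseudo-inverse of A is a pseudo-inverse of the transpose,
    and pseudo-inverses are unique. *)
Lemma mp_pinv_sym n (A : 'M[R]_n) : A^T = A -> (mp_pinv A)^T = mp_pinv A.
Proof.
move=> As; apply: (@penrose_unique _ _ _ A); last exact: mp_pinvP.
by rewrite -{1}As; exact/penrose_trmx/mp_pinvP.
Qed.

End mp_pinv_symmetric.

(** * The residual functional *)

Lemma sqrt_add_sqr_le (R : rcfType) (x y : R) :
  Num.sqrt (x + y ^+ 2) <= Num.sqrt x + `|y|.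
Proof.
have h : 0 <= Num.sqrt x + `|y| by rewrite addr_ge0.
rewrite -[leRHS](ger0_norm h) -(sqrtr_sqr (_ + _)) ler_wsqrtr// sqrrD real_normK ?num_real//.
rewrite lerD2r (@le_trans _ _ (Num.sqrt x ^+ 2))//.
  have [x0|/ltW x0] := leP 0 x; first by rewrite sqr_sqrtr.
  by rewrite (le_trans x0)// sqr_ge0.
by rewrite lerDl mulrn_wge0// mulr_ge0.
Qed.

Section kernel_moments.
Variables (R : realType) (B : completeNormedModType R).
Variables (P : probability (borelType B) R) (mu : B).
Variable K : dual_space B -> dual_space B -> R.
Hypothesis hP : kernel_based P mu K.

(** Two-point laws determine all the second moments below: applying the
    definition of a kernel-based measure to the pair (L, L') gives the mean of
    each and their covariance. *)
Lemma kernel_based_moments (L L' : dual_space B) :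
  [/\ measurable_fun [set: borelType B] (fun w : B => L w : R),
      P.-integrable setT (EFin \o (fun w : B => (L w : R) * (L' w : R))) &
      \int[P]_w ((L (w : B) : R) * (L' (w : B) : R)) = K L L' + (L mu : R) * (L' mu : R)].
Proof.
pose Ls (i : 'I_2) := if i == ord0 then L else L'.
have [mX _ EX cX] := hP Ls.
have e w i : dual_vec Ls w i 0 = Ls i w by rewrite mxE.
have mL i : measurable_fun [set: borelType B] (fun w : B => Ls i w : R).
  by under eq_fun do rewrite -e; exact: mX.
have EL i : 'E_P[(fun w : B => Ls i w : R)]%E = (Ls i mu : R)%:E.
  by under eq_fun do rewrite -e; rewrite EX e.
have cL : covariance P (fun w : B => L w : R) (fun w : B => L' w : R) = (K L L')%:E.
  have := cX ord0 ord_max; rewrite mxE.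
  by under eq_fun do rewrite e; under [in X in covariance _ _ X]eq_fun do rewrite e.
have [? ?] := covariance_second_moment (mL ord0) (mL ord_max) (EL ord0) (EL ord_max) cL.
by split => //; exact: (mL ord0).
Qed.

Lemma kernel_sym (L L' : dual_space B) : K L L' = K L' L.
Proof.
have [_ _ e] := kernel_based_moments L L'.
have [_ _ e'] := kernel_based_moments L' L.
apply: (@addIr _ ((L mu : R) * (L' mu : R))).
rewrite -e [in RHS]mulrC -e'.
by apply: eq_Rintegral => w _; rewrite mulrC.
Qed.

Lemma kernel_mx_sym n (Ls : 'I_n -> dual_space B) :
  (kernel_mx K Ls)^T = kernel_mx K Ls.
Proof. by apply/matrixP => i j; rewrite !mxE kernel_sym. Qed.

Lemma kernel_beta_tr n (Ls : 'I_n -> dual_space B) L :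
  (kernel_beta K Ls L)^T = (kernel_vec K Ls L)^T *m mp_pinv (kernel_mx K Ls).
Proof. by rewrite trmx_mul mp_pinv_sym// kernel_mx_sym. Qed.

Definition residual n (Ls : 'I_n -> dual_space B) (L : dual_space B) (w : B) : R :=
  L w - \sum_(j < n) kernel_beta K Ls L j 0 * Ls j w.

Lemma measurable_residual n (Ls : 'I_n -> dual_space B) (L : dual_space B) :
  measurable_fun [set: borelType B] (residual Ls L).
Proof.
apply: measurable_funB; first by have [] := kernel_based_moments L L.
apply: measurable_sum => j; apply: measurable_funM => //.
by have [] := kernel_based_moments (Ls j) L.
Qed.

(** Variance plus squared mean: with q = b^T A^+ b, both beta^T b and
    beta^T A beta equal q, so the variance K(L,L) - 2 beta^T b + beta^T A beta
    is K(L,L) - q. *)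
Lemma residual_second_moment n (Ls : 'I_n -> dual_space B) (L : dual_space B) :
  P.-integrable [set: borelType B] (EFin \o (fun w => residual Ls L w ^+ 2)) /\
  \int[P]_w (residual Ls L w ^+ 2) =
    K L L - ((kernel_vec K Ls L)^T *m mp_pinv (kernel_mx K Ls) *m kernel_vec K Ls L) 0 0
    + residual Ls L mu ^+ 2.
Proof.
set be := kernel_beta K Ls L.
have sqE (w : B) : residual Ls L w ^+ 2 =
    (L w : R) * (L w : R) +
    (\sum_(j < n) (- (2 * be j 0)) * ((L w : R) * (Ls j w : R)) +
     \sum_(j < n) \sum_(i < n) (be i 0 * be j 0) * ((Ls i w : R) * (Ls j w : R))).
  rewrite /residual -/be sqrrB expr2 -addrA; congr (_ + _).
  rewrite [X in _ = X + _](_ : _ = - (2 * ((L w : R) * \sum_j be j 0 * Ls j w))); last first.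
    rewrite !mulr_sumr -sumrN; apply: eq_bigr => j _; ring.
  rewrite mulr_natl; congr (_ + _).
  rewrite expr2 mulr_suml exchange_big/=; apply: eq_bigr => i _.
  rewrite mulr_sumr; apply: eq_bigr => j _; ring.
have mo L1 L2 := let: And3 _ i e := kernel_based_moments L1 L2 in conj i e.
have iLL := (mo L L).1.
have iLj j := integrable_realZ (- (2 * be j 0)) (mo L (Ls j)).1.
have iij j i := integrable_realZ (be i 0 * be j 0) (mo (Ls i) (Ls j)).1.
have is1 := integrable_real_sum iLj.
have is2' j := integrable_real_sum (iij j).
have is2 := integrable_real_sum is2'.
rewrite (funext sqE : (fun w : borelType B => residual Ls L w ^+ 2) = _).
split; first exact: integrable_realD iLL (integrable_realD is1 is2).
rewrite (RintegralD measurableT iLL (integrable_realD is1 is2)).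
rewrite (RintegralD measurableT is1 is2) !Rintegral_sum//.
under eq_bigr => j _ do rewrite (RintegralZl _ measurableT (mo L (Ls j)).1) (mo L (Ls j)).2.
under [X in _ + (_ + X)]eq_bigr => j _.
  rewrite Rintegral_sum//.
  under eq_bigr => i _ do
    rewrite (RintegralZl _ measurableT (mo (Ls i) (Ls j)).1) (mo (Ls i) (Ls j)).2 mulrDr.
  rewrite big_split/=; over.
under eq_bigr => j _ do rewrite mulrDr.
rewrite (mo L L).2 big_split/= sqE.
(* S1 and S3 collect the covariances, S2 and S4 the products of means; the
   latter already add up to the square of the residual at mu. *)
set S1 := \sum_j _ * K _ _; set S2 := \sum_j _ * (_ * _).
rewrite big_split/=; set S3 := \sum_j \sum_i _ * K _ _.
set S4 := \sum_j \sum_i _ * (_ * _); set q := (_ *m _) 0 0.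
suff : S1 + S3 = - q by lra.
have -> : S1 = - (2 * q).
  rewrite /q -kernel_beta_tr mxE mulr_sumr -sumrN; apply: eq_bigr => j _.
  by rewrite !mxE -/be; ring.
have -> : S3 = q.
  have -> : q = (be^T *m kernel_mx K Ls *m be) 0 0.
    rewrite /q /be kernel_beta_tr /kernel_beta -!mulmxA (mulmxA (kernel_mx _ _)).
    rewrite mulmxA -mulmxA.
    have [_ e _ _] := mp_pinvP (kernel_mx K Ls).
    by rewrite (mulmxA (mp_pinv _)) (mulmxA (mp_pinv _)) e.
  rewrite quad_formE; apply: eq_bigr => j _; apply: eq_bigr => i _.
  by rewrite !mxE; ring.
by ring.
Qed.

(** Square integrability of V and of each functional makes L(V(w) w) = V(w) L(w)
    integrable, so each functional can be applied under the Bochner integral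
    defining u. *)
Lemma Gamma_residual V u n (Ls : 'I_n -> dual_space B) (L : dual_space B) :
  V \in Lfun P 2%:E -> Gamma P V u ->
  residual Ls L u = \int[P]_w (V w * residual Ls L w).
Proof.
move=> V2 GV.
have mV : measurable_fun setT V by move: V2; rewrite inE => /andP[/[!inE]].
have iV := Lfun2_integrable_sqr V2.
have iVL (M : dual_space B) : P.-integrable [set: borelType B]
    (EFin \o (fun w : B => V w * (M w : R))).
  have [mM iM _] := kernel_based_moments M M.
  exact: integrable_mul_sqr.
have uL (M : dual_space B) : (M u : R) = \int[P]_w (V w * (M (w : B) : R)).
  have e (w : B) : (M (V w *: w) : R) = V w * (M w : R) by rewrite linearZ.
  transitivity (\int[P]_w (M (V w *: (w : B)) : R)); last by apply: eq_Rintegral => w _.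
  apply: dual_bochner_integral => //.
  rewrite (_ : (fun w : B => M (V w *: w) : R) = (fun w => V w * (M w : R)))//.
  exact/funext.
have iZ j := integrable_realZ (- kernel_beta K Ls L j 0) (iVL (Ls j)).
transitivity (\int[P]_w (V w * (L (w : B) : R) +
    \sum_(j < n) (- kernel_beta K Ls L j 0) * (V w * (Ls j (w : B) : R)))); last first.
  apply: eq_Rintegral => w _; rewrite /residual mulrBr mulr_sumr -sumrN.
  by congr (_ + _); apply: eq_bigr => j _; ring.
rewrite RintegralD//; last exact: integrable_real_sum.
rewrite Rintegral_sum// -uL /residual -sumrN; congr (_ + _).
by apply: eq_bigr => j _; rewrite RintegralZl// -uL mulNr.
Qed.

(** The constant multiplying sigma and the bias is the L_2 norm of V, which does
    not depend on the functionals; this is what makes C1 and C2 uniform. *)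
Lemma residual_bound V u n (Ls : 'I_n -> dual_space B) (L : dual_space B) :
  V \in Lfun P 2%:E -> Gamma P V u ->
  `|residual Ls L u| <= Num.sqrt (\int[P]_w (V w ^+ 2)) *
    (kernel_sigma K Ls L + `|residual Ls L mu|).
Proof.
move=> V2 GV; rewrite (Gamma_residual _ _ V2 GV).
have mV : measurable_fun setT V by move: V2; rewrite inE => /andP[/[!inE]].
have [iD ID] := residual_second_moment Ls L.
apply: (le_trans (cauchy_schwarz_Rintegral mV (measurable_residual Ls L)
  (Lfun2_integrable_sqr V2) iD)).
by rewrite ler_wpM2l ?sqrtr_ge0// ID sqrt_add_sqr_le.
Qed.

(** Writing s(L) = L mu + beta^T (eta - L_n mu) and adding and subtracting
    beta^T L_n u separates the part due to replacing L by beta^T L_n from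
    the part due to inexact data. *)
Lemma interpolant_error n (Ls : 'I_n -> dual_space B) (L : dual_space B) u fhat eps :
  (L u : R) - kernel_interpolant mu K Ls fhat eps L =
  residual Ls L u - residual Ls L mu +
  \sum_(j < n) kernel_beta K Ls L j 0 *
    ((Ls j u : R) - kernel_eta mu K Ls eps fhat j 0).
Proof.
rewrite /kernel_interpolant -kernel_beta_tr mxE /residual.
rewrite (eq_bigr (fun j => kernel_beta K Ls L j 0 * kernel_eta mu K Ls eps fhat j 0 -
    kernel_beta K Ls L j 0 * (Ls j mu : R))); last first.
  move=> j _; rewrite -mulrBr; congr (_ * _); first by rewrite mxE.
  by rewrite mxE; congr (_ + _); rewrite !mxE.
under [X in _ = _ + X]eq_bigr => j _ do rewrite mulrBr.
by rewrite !sumrB; ring.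
Qed.

End kernel_moments.

(** * The error bound *)

Theorem theorem3p16 (R : realType) (B : completeNormedModType R)
    (P : probability (borelType B) R) (mu : B) (K : dual_space B -> dual_space B -> R)
    (hP : kernel_based P mu K) (u : B) (hu : range_Gamma P u) :
  exists C1 C2 : R, [/\ 0 <= C1, 0 <= C2 &
    forall (n : nat) (Ls : 'I_n -> dual_space B), kernel_mx K Ls != 0 ->
    forall L : dual_space B,
    exists2 M : R, 0 <= M &
      forall (eps : R) (fhat : 'cV[R]_n), 0 < eps ->
        euclid_norm (dual_vec Ls u - fhat) <= eps ->
        `|L u - kernel_interpolant mu K Ls fhat eps L| <=
          C1 * kernel_sigma K Ls L
          + C2 * `|L mu - ((kernel_beta K Ls L)^T *m dual_vec Ls mu) 0 0|
          + M * eps].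
Proof.
have [V [V2 _] GV] := hu.
set C := Num.sqrt (\int[P]_w (V w ^+ 2)).
have C0 : 0 <= C by exact: sqrtr_ge0.
exists C, (C + 1); split; [exact: C0|exact: addr_ge0|] => n Ls _ L.
set be := kernel_beta K Ls L.
exists (\sum_(j < n) `|be j 0| * 2) => [|eps fhat e0 ue].
  by apply: sumr_ge0 => j _; rewrite mulr_ge0.
have -> : (L mu : R) - (be^T *m dual_vec Ls mu) 0 0 = residual K Ls L mu.
  by rewrite /residual mxE; congr (_ - _); apply: eq_bigr => j _; rewrite !mxE.
rewrite (interpolant_error hP).
have hD := residual_bound hP Ls L V2 GV; rewrite -/C in hD.
have hS : `|\sum_(j < n) be j 0 * ((Ls j u : R) - kernel_eta mu K Ls eps fhat j 0)|
    <= (\sum_(j < n) `|be j 0| * 2) * eps.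
  rewrite mulr_suml (le_trans (ler_norm_sum _ _ _))// ler_sum// => j _.
  rewrite normrM -mulrA ler_wpM2l// -(subrKA (fhat j 0)) mulr_natl mulr2n.
  rewrite (le_trans (ler_normD _ _))// lerD//.
    by have := le_trans (euclid_norm_coord _ j) ue; rewrite !mxE.
  by rewrite distrC; exact: kernel_eta_near.
apply: (le_trans (ler_normD _ _)); apply: lerD hS.
apply: (le_trans (ler_normB _ _)).
by rewrite mulrDl mul1r addrA -mulrDr lerD2r.
Qed.
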